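(* Let $n$ and $k$ be integers. (i) If $k\ge 2$ and $n\ge k+2$, then $$\mathrm{ex}_k(n,\mathcal C_4^{k+})\le \mu(J(n,k))\le \mathrm{ex}_k(n,\mathcal K_4^{k+}).$$ (ii) If $n\ge 4$, then $$\mu(J(n,2))=\mu(J(n,n-2))=\left\lfloor\frac{n^2}{3}\right\rfloor.$$ Here $\mu$ denotes the mutual-visibility number, $J(n,k)$ the Johnson graph, and $\mathcal C_4^{k+}$, $\mathcal K_4^{k+}$ the $k$-uniform suspensions of the $4$-cycle $C_4$ and of the complete graph $K_4$.
   Context: Johnson graph: $J(n,k)$ has as vertices the $k$-element subsets of $[n]=\{1,\dots,n\}$; two vertices $A,B$ are adjacent if and only if $|A\cap B|=k-1$. Mutual-visibility: Let $G$ be a connected graph and $\mathcal X\subseteq V(G)$. Two vertices $u,v\in V(G)$ are $\mathcal X$-visible if there is a shortest $u,v$-path $P$ in $G$ with no internal vertex in $\mathcal X$, i.e. $V(P)\cap\mathcal X\subseteq\{u,v\}$. The set $\mathcal X$ is a mutual-visibility set if any two vertices of $\mathcal X$ are $\mathcal X$-visible. The mutual-visibility number $\mu(G)$ is the largest cardinality of a mutual-visibility set in $G$. A hypergraph is $k$-uniform (a $k$-graph) if every edge consists of exactly $k$ vertices. For $k\ge 2$, the $k$-uniform suspensions $\mathcal C_4^{k+}$ and $\mathcal K_4^{k+}$ are the $k$-graphs on the $(k+2)$-element vertex set $Y\cup\{z_1,z_2,z_3,z_4\}$ (with $|Y|=k-2$, $Y$ disjoint from the four distinct vertices $z_i$),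 where the edges of $\mathcal C_4^{k+}$ are the four sets $Y\cup\{z_1,z_2\}$, $Y\cup\{z_2,z_3\}$, $Y\cup\{z_3,z_4\}$, $Y\cup\{z_4,z_1\}$, and the edges of $\mathcal K_4^{k+}$ are all six sets $Y\cup\{z_i,z_j\}$ with $1\le i<j\le 4$. Turán number: for a $k$-graph $\mathcal F$, $\mathrm{ex}_k(n,\mathcal F)$ is the maximum number of edges in a $k$-graph on $n$ vertices containing no (not necessarily induced) subhypergraph isomorphic to $\mathcal F$. *)

(* Defs.v *)
From mathcomp Require Import all_boot.
From mathcomp Require Import boolp.

Set Implicit Arguments.
Unset Strict Implicit.
Unset Printing Implicit Defensive.

(* Finite graphs are given by their adjacency relation [e : rel T].  A path
   from [u] to [v] is [u :: p], so its length is [size p]. *)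

Definition is_path (T : finType) (e : rel T) (u v : T) (p : seq T) : Prop :=
  [/\ path e u p, uniq (u :: p) & last u p = v].

Definition shortest_path (T : finType) (e : rel T) (u v : T) (p : seq T) : Prop :=
  is_path e u v p /\ forall q : seq T, is_path e u v q -> size p <= size q.

Definition visible (T : finType) (e : rel T) (X : {set T}) (u v : T) : Prop :=
  exists2 p : seq T, shortest_path e u v p
    & forall w : T, w \in u :: p -> w \in X -> w = u \/ w = v.

Definition mutual_visibility_set (T : finType) (e : rel T) (X : {set T}) : Prop :=
  forall u v : T, u \in X -> v \in X -> u != v -> visible e X u v.

Definition mu (T : finType) (e : rel T) : nat :=
  \max_(X : {set T} | `[< mutual_visibility_set e X >]) #|X|.

(* Writing [.+1] on the left avoids truncated subtraction, which would put a
   loop at the unique vertex when [k = 0]. *)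
Definition johnson (n k : nat) : rel {A : {set 'I_n} | #|A| == k} :=
  fun A B => #|val A :&: val B|.+1 == k.

Arguments johnson n k A B : clear implicits.

(* Hypergraphs on the vertex type [V] are given by their edge sets. *)

Definition uniform (V : finType) (k : nat) (H : {set {set V}}) : bool :=
  [forall A in H, #|A| == k].

(* [H] has a not necessarily induced subhypergraph isomorphic to [F]. *)
Definition contains (U V : finType) (F : {set {set U}}) (H : {set {set V}}) : bool :=
  [exists f : {ffun U -> V}, injectiveb f && [forall A in F, f @: A \in H]].

Definition turan_number (k n : nat) (U : finType) (F : {set {set U}}) : nat :=
  \max_(H : {set {set 'I_n}} | uniform k H && ~~ contains F H) #|H|.

Definition C4 : {set {set 'I_4}} := [set [set i; ordS i] | i : 'I_4].

Definition K4 : {set {set 'I_4}} :=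
  [set [set ij.1; ij.2] | ij : 'I_4 * 'I_4 & ij.1 < ij.2].

(* The left summand is the set [Y] of [k - 2] new vertices added to every edge
   (meaningful for [2 <= k] only); the right summand is the vertex set
   of the graph [G]. *)
Definition suspension (k : nat) (V : finType) (G : {set {set V}}) :
    {set {set 'I_(k - 2) + V}} :=
  [set [set inl y | y : 'I_(k - 2)] :|: [set inr z | z in A] | A : {set V} in G].

(* Main.v *)
Require Import Defs.
From mathcomp Require Import all_boot.
From mathcomp Require Import boolp zify.

(** Shortest paths from [A] to [B] in the Johnson graph exchange the elements
    of [A :\: B] for those of [B :\: A] one at a time, in any order
    ([johnson_walk_size], [swap_vertex], [closer_neighbour]).

    Lower bound: let the [k]-graph [X] contain no suspended 4-cycle.  When [A]
    and [B] are at distance at least two, pick [a], [a'] in [A :\: B] and [b],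
    [b'] in [B :\: A]: the four vertices that [A] reaches by exchanging one of
    [a], [a'] for one of [b], [b'] are the edges of a suspended 4-cycle, so one
    of them is outside [X].  Going there and repeating gives a shortest path
    that avoids [X] until it arrives ([C4_free_mutual_visibility]).

    Upper bound: in a suspended [K4], two opposite edges [Y z0 z1] and
    [Y z2 z3] are at distance two, and their common neighbours are exactly the
    four other edges; they do not see each other if all six edges lie in [X]
    ([mutual_visibility_K4_free]).

    For [k = 2] the upper bound is attained: two vertices at distance two are
    disjoint pairs, and they see each other unless all four pairs between them
    belong to [X], that is, unless these four points span a [K4]
    ([mu_johnson2]).  So [mu] is the Turan number of [K4], which is
    [n ^ 2 %/ 3]: the upper bound is Turan's theorem ([turan_bound]) and the
    balanced complete tripartite graph attains it ([turan_number_K4]).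
    Complementation is an isomorphism from [J(n, 2)] to [J(n, n - 2)]
    ([mu_johnson_compl_le]). *)

Set Implicit Arguments.
Unset Strict Implicit.
Unset Printing Implicit Defensive.

(** * Suspensions *)

(** Separates an embedding of the suspension into the image [Y] of the added
    vertices and the embedding [g] of the graph, so that copies can be built and
    taken apart without the sum type. *)
Lemma contains_suspensionP (k : nat) (V W : finType) (G : {set {set V}})
    (H : {set {set W}}) :
  reflect
    (exists Y : {set W}, exists g : V -> W,
       [/\ #|Y| = k - 2, injective g, forall z, g z \notin Y
         & forall A, A \in G -> Y :|: g @: A \in H])
    (contains (suspension k G) H).
Proof.
apply: (iffP existsP) => [[f /andP[/injectiveP f_inj /forall_inP fH]]|].
  exists [set f (inl y) | y : 'I_(k - 2)], (fun z => f (inr z)); split.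
  - by rewrite card_imset ?card_ord // => y y' /f_inj [].
  - by move=> z z' /f_inj [].
  - by move=> z; apply/imsetP => -[y _ /f_inj].
  move=> A AG; have := fH _ (imset_f _ AG); rewrite imsetU.
  by rewrite -!imset_comp.
case=> Y [g [cardY g_inj gY gH]].
(* The added vertices are sent to [Y] along the enumeration of [Y]. *)
pose h (x : 'I_(k - 2) + V) :=
  match x with inl y => enum_val (cast_ord (esym cardY) y) | inr z => g z end.
have hY y : h (inl y) \in Y by apply: enum_valP.
have Yh : Y = [set h (inl y) | y : 'I_(k - 2)].
  apply/setP => w; apply/idP/imsetP => [wY|[y _ ->]//].
  exists (cast_ord cardY (enum_rank_in wY w)) => //=.
  by rewrite cast_ordK enum_rankK_in.
exists [ffun x => h x]; apply/andP; split.
  apply/injectiveP => x x'; rewrite !ffunE.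
  case: x x' => [y|z] [y'|z'].
  - by move=> /enum_val_inj /cast_ord_inj ->.
  - by move=> hh; have := gY z'; rewrite -[g z']hh hY.
  - by move=> hh; have := gY z; rewrite -[g z]/(h (inr z)) hh hY.
  - by move=> /g_inj ->.
apply/forall_inP => _ /imsetP[A AG ->].
rewrite imsetU -!imset_comp; have := gH A AG; rewrite {1}Yh.
congr (_ \in H); congr (_ :|: _); apply: eq_imset => x /=;
  by rewrite ffunE.
Qed.

Lemma K4P (A : {set 'I_4}) :
  reflect (exists i j : 'I_4, i != j /\ A = [set i; j]) (A \in K4).
Proof.
apply: (iffP imsetP) => [[[i j] /=]|[i [j [ij ->]]]].
  by rewrite inE /= => ij ->; exists i, j; split=> //; rewrite neq_ltn ij.
move: ij; rewrite neq_ltn => /orP[ij|ij].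
  by exists (i, j); rewrite ?inE.
by exists (j, i); rewrite ?inE // setUC.
Qed.

(** * Visibility in an arbitrary graph *)

(** The only shortest paths between vertices at distance two go through one
    common neighbour, and that neighbour is internal. *)
Lemma visible_common_neighbour (T : finType) (e : rel T) (X : {set T})
    (u v c : T) :
  irreflexive e -> u != v -> ~~ e u v -> e u c -> e c v -> visible e X u v ->
  exists2 w, w \notin X & e u w && e w v.
Proof.
move=> e_irr uv nuv euc ecv [p [[p_path p_uniq p_last] p_min] p_X].
have : size p <= 2.
  apply: (p_min [:: c; v]); split; rewrite /= ?euc ?ecv // !inE negb_or uv !andbT.
  apply/andP; split; first by apply: contraTneq euc => ->; rewrite e_irr.
  by apply: contraTneq ecv => ->; rewrite e_irr.
case: p p_path p_uniq p_last p_X {p_min} => [|w [|w' []]] //=.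
- by move=> _ _ uvE; rewrite uvE eqxx in uv.
- by move=> /andP[euw _] _ wv; rewrite -wv euw in nuv.
move=> /and3P[euw eww' _] /and3P[]; rewrite !inE negb_or.
move=> /andP[uw _] ww' _ w'v p_X _; subst w'.
exists w; last by rewrite euw.
apply/negP => /p_X; rewrite !inE eqxx orbT => /(_ isT) [] wE.
  by rewrite wE eqxx in uw.
by rewrite wE eqxx in ww'.
Qed.

(** Transports [mu] along an isomorphism.  The inverse [g] is needed to bring
    competing paths back to the first graph, where minimality is known. *)
Lemma mu_isomorphism (T T' : finType) (e : rel T) (e' : rel T') (f : T -> T') (g : T' -> T) :
  cancel f g -> cancel g f -> (forall x y, e' (f x) (f y) = e x y) ->
  mu e <= mu e'.
Proof.
move=> fK gK ef; have f_inj := can_inj fK.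
have eg x y : e (g x) (g y) = e' x y by rewrite -ef !gK.
apply/bigmax_leqP => X /asboolP X_vis.
rewrite -(card_imset (mem X) f_inj); apply: leq_bigmax_cond.
apply/asboolP => _ _ /imsetP[u uX ->] /imsetP[v vX ->]; rewrite inj_eq // => uv.
have [p [[p_path p_uniq p_last] p_min] p_X] := X_vis u v uX vX uv.
exists (map f p); first split.
- split; first by rewrite path_map (eq_path ef).
    by rewrite -map_cons map_inj_uniq.
  by rewrite last_map p_last.
- move=> q [q_path q_uniq q_last]; rewrite size_map -(size_map g).
  apply: p_min; split; first by rewrite -[u]fK path_map (eq_path eg).
    by rewrite -[u]fK -map_cons map_inj_uniq //; apply: can_inj gK.
  by rewrite -[u]fK last_map q_last fK.
move=> w; rewrite -map_cons => /mapP[x xp ->]; rewrite mem_imset // => xX.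
by case: (p_X x xp xX) => ->; [left|right].
Qed.

(** * Distance in the Johnson graph *)

Section Johnson.
Variables n k : nat.
Implicit Types A B C : {A : {set 'I_n} | #|A| == k}.
Implicit Type X : {set {A : {set 'I_n} | #|A| == k}}.

Lemma card_vertex A : #|val A| = k.
Proof. exact/eqP/(valP A). Qed.

Lemma card_diffC A B : #|val A :\: val B| = #|val B :\: val A|.
Proof. by rewrite !cardsD !card_vertex setIC. Qed.

Lemma johnsonE A B : johnson n k A B = (#|val A :\: val B| == 1).
Proof.
rewrite /johnson -[X in _ == X](card_vertex A) -(cardsID (val B) (val A)).
by rewrite -addn1 eqn_add2l eq_sym.
Qed.

Lemma johnson_irr : irreflexive (johnson n k).
Proof. by move=> A; rewrite johnsonE setDv cards0. Qed.

Lemma vertex_neq A B : (A != B) = (0 < #|val A :\: val B|).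
Proof.
rewrite -[A == B](inj_eq val_inj) eqEcard !card_vertex leqnn andbT.
by rewrite -setD_eq0 card_gt0.
Qed.

(** Each step of a walk removes at most one element of [A :\: B]; hence the
    distance from [A] to [B] is at least [#|A :\: B|]. *)
Lemma johnson_walk_size A B p :
  path (johnson n k) A p -> last A p = B -> #|val A :\: val B| <= size p.
Proof.
elim: p A => [|C p IHp] A /=; first by move=> _ ->; rewrite setDv cards0.
rewrite johnsonE => /andP[/eqP adjAC /IHp CB] {}/CB CB.
have : val A :\: val B \subset (val A :\: val C) :|: (val C :\: val B).
  apply/subsetP => x; rewrite !inE => /andP[-> ->]; rewrite andbT.
  by case: (x \in val C).
move=> /subset_leq_card /leq_trans; apply; rewrite -add1n -adjAC.
by apply: leq_trans (leq_card_setU _ _) _; rewrite leq_add2l.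
Qed.

(** A walk as short as the lower bound on the distance contains a shortest path,
    so that repeated vertices need not be excluded when one is built. *)
Lemma visible_of_walk X A B p :
  path (johnson n k) A p -> last A p = B -> size p = #|val A :\: val B| ->
  (forall C, C \in p -> C \in X -> C = B) -> visible (johnson n k) X A B.
Proof.
move=> p_path p_last p_size p_X.
case: (shortenP p_path) p_last => q q_path q_uniq q_p q_last.
exists q; first split=> //.
  move=> r [r_path _ r_last]; apply: leq_trans (johnson_walk_size r_path r_last).
  by rewrite -p_size uniq_leq_size //; case/andP: q_uniq.
move=> C; rewrite inE => /orP[/eqP->|Cq CX]; first by left.
by right; apply: p_X => //; apply: q_p.
Qed.

Lemma swap_vertex A B a b :
  a \in val A :\: val B -> b \in val B :\: val A ->
  exists C, [/\ val C = b |: val A :\ a, johnson n k A C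
    & #|val A :\: val B| = #|val C :\: val B|.+1].
Proof.
rewrite !inE => /andP[aB aA] /andP[bA bB].
have ba : b != a by apply: contraNneq bA => ->.
have cardC : #|b |: val A :\ a| == k.
  rewrite cardsU1 !inE (negbTE bA) andbF /=.
  by apply/eqP; rewrite -[RHS](card_vertex A) [RHS](cardsD1 a) aA.
exists (exist (fun S : {set _} => #|S| == k) _ cardC); split=> //.
  rewrite johnsonE /= [_ :\: _](_ : _ = [set a]) ?cards1 //.
  apply/setP => x; rewrite !inE; case: (eqVneq x a) => [->|xa] /=.
    by rewrite aA eq_sym (negbTE ba).
  by rewrite andbC; case: (x \in val A); rewrite ?orbT.
rewrite (cardsD1 a) !inE aB aA /= add1n; congr _.+1; apply: eq_card => x.
rewrite !inE; case: (eqVneq x b) => [->|xb] /=; first by rewrite bB andbF.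
by case: (x == a) => /=; rewrite ?andbF.
Qed.

(** Converse of [swap_vertex]: a step that lowers the distance to [B] is such an
    exchange.  Removing an element of [B] would gain nothing, and adding an
    element outside [B] would compensate the removal. *)
Lemma closer_neighbour A B C :
  johnson n k A C -> #|val A :\: val B| = #|val C :\: val B|.+1 ->
  exists a b, [/\ a \in val A :\: val B, b \in val B :\: val A
    & val C = b |: val A :\ a].
Proof.
move=> adjAC AB.
have /cards1P[a AdC] : #|val A :\: val C| == 1 by rewrite -johnsonE.
have /cards1P[b CdA] : #|val C :\: val A| == 1 by rewrite -card_diffC -johnsonE.
have inA x : (x \in val A) && (x \notin val C) = (x == a).
  by have /setP/(_ x) := AdC; rewrite !inE andbC.
have inC x : (x \in val C) && (x \notin val A) = (x == b).
  by have /setP/(_ x) := CdA; rewrite !inE andbC.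
have /andP[aA aC] : (a \in val A) && (a \notin val C) by rewrite inA.
have /andP[bC bA] : (b \in val C) && (b \notin val A) by rewrite inC.
exists a, b; split.
- rewrite inE aA andbT; apply/negP => aB.
  suff /subset_leq_card : val A :\: val B \subset val C :\: val B by rewrite AB ltnn.
  apply/subsetP => x; rewrite !inE => /andP[xB xA]; rewrite xB /=.
  by apply: contraNT xB => xC; have := inA x; rewrite xA xC => /esym/eqP ->.
- rewrite inE bA /=; apply/negPn/negP => bB.
  suff /subset_leq_card : b |: (val A :\: val B) :\ a \subset val C :\: val B.
    rewrite cardsU1 !inE (negbTE bA) !andbF /= -ltnS -AB.
    by rewrite (cardsD1 a (val A :\: val B)) ltn_add2r ltnNge leq_b1.
  apply/subsetP => x; rewrite !inE => /orP[/eqP->|/and3P[xa xB xA]].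
    by rewrite bB.
  by rewrite xB /=; apply: contraNT xa => xC; rewrite -inA xA.
apply/setP => x; rewrite !inE -inA -inC.
by case: (x \in val A); case: (x \in val C).
Qed.

(** If all edges of a suspended [K4] were in [X], then opposite edges [A] and [B]
    would have a common neighbour outside [X]; but it is obtained from [A] by an
    exchange, which makes it one of the four remaining edges. *)
Lemma mutual_visibility_K4_free X :
  mutual_visibility_set (johnson n k) X ->
  ~~ contains (suspension k K4) (val @: X).
Proof.
move=> X_vis; apply/negP => /contains_suspensionP[Y [g [cardY g_inj gY gX]]].
have edge i j : i != j -> exists2 A, A \in X & val A = g i |: (g j |: Y).
  move=> ij; have : [set i; j] \in K4 by apply/K4P; exists i, j.
  move=> /gX /imsetP[A AX AE]; exists A => //.
  by rewrite -AE imsetU !imset_set1 setUC setUA.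
pose z := fun i => @inord 3 i.
have zE i j : i < 4 -> j < 4 -> (g (z i) == g (z j)) = (i == j).
  by move=> i4 j4; rewrite inj_eq // -val_eqE /= !inordK.
have [A AX AE] := edge (z 0) (z 1) ltac:(by rewrite -(inj_eq g_inj) zE).
have [B BX BE] := edge (z 2) (z 3) ltac:(by rewrite -(inj_eq g_inj) zE).
have AB : val A :\: val B = [set g (z 0); g (z 1)].
  apply/setP => x; rewrite AE BE !inE.
  case: (eqVneq x (g (z 0))) => [->|_] /=; first by rewrite !zE // (negbTE (gY _)).
  case: (eqVneq x (g (z 1))) => [->|_] /=; first by rewrite !zE // (negbTE (gY _)).
  by case: (x \in Y); rewrite ?orbT ?andbF.
have BA : val B :\: val A = [set g (z 2); g (z 3)].
  apply/setP => x; rewrite AE BE !inE.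
  case: (eqVneq x (g (z 2))) => [->|_] /=; first by rewrite !zE // (negbTE (gY _)).
  case: (eqVneq x (g (z 3))) => [->|_] /=; first by rewrite !zE // (negbTE (gY _)).
  by case: (x \in Y); rewrite ?orbT ?andbF.
have cardAB : #|val A :\: val B| = 2 by rewrite AB cards2 zE.
have nAB : A != B by rewrite vertex_neq cardAB.
(* Some common neighbour, which shows that the distance is two. *)
have [C [CE adjAC CB]] : exists C, [/\ val C = g (z 2) |: val A :\ g (z 0), johnson n k A C
    & #|val A :\: val B| = #|val C :\: val B|.+1].
  by apply: swap_vertex; rewrite ?AB ?BA !inE eqxx.
have [||D DX /andP[AD DB]] :=
  visible_common_neighbour johnson_irr nAB _ adjAC _ (X_vis A B AX BX nAB).
- by rewrite johnsonE cardAB.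
- by rewrite johnsonE -eqSS -CB cardAB.
have [|a [b [aAB bBA DE]]] := closer_neighbour (B := B) AD.
  by move: DB; rewrite johnsonE cardAB => /eqP->.
(* [A] without [a] plus [b] is the edge through [z j] and the element of
   [{z 0, z 1}] other than [a], namely [z (1 - i)]. *)
have [i [i2 aE]] : exists i, i < 2 /\ a = g (z i).
  by move: aAB; rewrite AB !inE => /orP[]/eqP->; [exists 0|exists 1].
have [j [j2 bE]] : exists j, [/\ 1 < j, j < 4 & b = g (z j)].
  by move: bBA; rewrite BA !inE => /orP[]/eqP->; [exists 2|exists 3].
case: bE => j4 bE.
have [|E EX EE] := edge (z j) (z (1 - i)).
  rewrite -(inj_eq g_inj) zE // ?ltnS; last exact: leq_trans (leq_subr _ _) _.
  by apply: contraTneq j2 => ->; rewrite -leqNgt leq_subr.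
suff DEq : D = E by rewrite DEq EX in DX.
apply: val_inj; rewrite DE AE bE; case: i i2 aE EE => [|[|]] // _ -> ->;
  congr (_ |: _); apply/setP => x; rewrite !inE.
  by case: (eqVneq x (g (z 0))) => [->|] //=; rewrite zE // (negbTE (gY _)).
by case: (eqVneq x (g (z 1))) => [->|] //=; rewrite zE // (negbTE (gY _)).
Qed.

(** Exchanges that leave [X] can be chosen greedily: the four exchanges of two
    elements for two others form a 4-cycle suspended from [A] minus both
    removed elements.  The start of the path may be outside [X], which lets the
    argument proceed by induction on the distance. *)
Lemma C4_free_mutual_visibility X :
  ~~ contains (suspension k C4) (val @: X) ->
  mutual_visibility_set (johnson n k) X.
Proof.
move=> C4free A B _ _; rewrite vertex_neq => AB.
suff [p [p_path p_last p_size p_X]] : exists p, [/\ path (johnson n k) A p, last A p = B,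
    size p = #|val A :\: val B| & forall C, C \in p -> C \in X -> C = B].
  exact: visible_of_walk p_path p_last p_size p_X.
have [d] := ubnP #|val A :\: val B|.
elim: d A AB => // d IHd A AB Ad.
have [AB1|AB2] := leqP #|val A :\: val B| 1.
  have {}AB1 : #|val A :\: val B| == 1 by rewrite eqn_leq AB1.
  exists [:: B]; split; rewrite /= ?johnsonE ?AB1 ?(eqP AB1) //.
  by move=> C; rewrite inE => /eqP.
suff [a [b [aAB bBA abX]]] : exists a b, [/\ a \in val A :\: val B, b \in val B :\: val A
    & b |: val A :\ a \notin val @: X].
  have [C [CE adjAC CB]] := swap_vertex aAB bBA.
  have [||p [p_path p_last p_size p_X]] := IHd C; [by rewrite -ltnS -CB|by rewrite -ltnS -CB|].
  exists (C :: p); split; rewrite /= ?adjAC ?p_size ?CB //.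
  move=> D; rewrite inE => /orP[/eqP->|]; last exact: p_X.
  by move=> CX; rewrite -CE imset_f in abX.
have /card_gt1P[a [a' [aAB a'AB aa']]] := AB2.
have /card_gt1P[b [b' [bBA b'BA bb']]] : 1 < #|val B :\: val A| by rewrite -card_diffC.
apply: contrapT => no_swap.
have swapX c d' : c \in val A :\: val B -> d' \in val B :\: val A ->
    d' |: val A :\ c \in val @: X.
  by move=> cAB dBA; apply: contrapT => /negP cdX; apply: no_swap; exists c, d'.
have [[aB aA] [a'B a'A]] :
    (a \notin val B /\ a \in val A) /\ (a' \notin val B /\ a' \in val A).
  by split; apply/andP; rewrite -in_setD.
have [[bA bB] [b'A b'B]] :
    (b \notin val A /\ b \in val B) /\ (b' \notin val A /\ b' \in val B).
  by split; apply/andP; rewrite -in_setD.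
case/negP: C4free; apply/contains_suspensionP.
(* Exchanging [a] leaves [a'] and conversely, so that the 4-cycle alternates
   between removed and added elements. *)
exists (val A :\ a :\ a'), (fun i : 'I_4 => nth a [:: a; b; a'; b'] i); split.
- rewrite -[X in X - 2](card_vertex A) [in RHS](cardsD1 a) [in RHS](cardsD1 a').
  by rewrite !inE aA a'A eq_sym aa' addnA addKn.
- have ne x y : x \in val A -> y \notin val A -> x != y.
    by move=> xA; apply: contraNneq => <-.
  move=> i j /eqP; rewrite nth_uniq //; first by move=> /eqP/val_inj.
  by rewrite /= !inE !negb_or aa' bb' (eq_sym b) !ne.
- have bN x : x \in val B -> x \notin val A -> x \notin val A :\ a :\ a'.
    by move=> _ xA; rewrite !inE (negbTE xA) !andbF.
  by case=> [[|[|[|[|]]]]] //= _; first [exact: bN | rewrite !inE eqxx ?andbF].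
have keep c c' d' : c \in val A -> c' \in val A -> c' != c ->
    val A :\ c' :\ c :|: [set c; d'] = d' |: val A :\ c'.
  move=> cA c'A cc'; apply/setP => x; rewrite !inE.
  case: (eqVneq x c) => [->|] /=; last by case: (x == d') => /=; rewrite ?orbT ?orbF.
  by rewrite cA (eq_sym c c') cc' orbT.
have sC : val A :\ a :\ a' = val A :\ a' :\ a by rewrite !setDDl setUC.
move=> _ /imsetP[i _ ->]; rewrite imsetU !imset_set1.
case: i => [[|[|[|[|]]]]] //= _.
- by rewrite sC keep 1?eq_sym // swapX.
- by rewrite [[set b; a']]setUC keep // swapX.
- by rewrite keep // swapX.
- by rewrite [[set b'; a]]setUC sC keep 1?eq_sym // swapX.
Qed.

Lemma vertices_of_uniform (H : {set {set 'I_n}}) :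
  uniform k H -> exists X, val @: X = H.
Proof.
move=> /forall_inP H_unif; exists [set A | val A \in H].
apply/setP => S; apply/imsetP/idP => [[A]|SH]; first by rewrite inE => ? ->.
by exists (Sub S (H_unif S SH)); rewrite ?inE.
Qed.

Lemma turan_le_mu (U : finType) (F : {set {set U}}) :
  (forall X, ~~ contains F (val @: X) -> mutual_visibility_set (johnson n k) X) ->
  turan_number k n F <= mu (johnson n k).
Proof.
move=> F_vis; apply/bigmax_leqP => H /andP[/vertices_of_uniform[X <-] /F_vis X_vis].
by rewrite (card_imset _ val_inj); apply: leq_bigmax_cond; apply/asboolP.
Qed.

Lemma mu_le_turan (U : finType) (F : {set {set U}}) :
  (forall X, mutual_visibility_set (johnson n k) X -> ~~ contains F (val @: X)) ->
  mu (johnson n k) <= turan_number k n F.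
Proof.
move=> vis_F; apply/bigmax_leqP => X /asboolP /vis_F X_free.
rewrite -(card_imset _ val_inj).
apply: leq_bigmax_cond; rewrite X_free andbT.
by apply/forall_inP => _ /imsetP[A _ ->]; apply/eqP/card_vertex.
Qed.

End Johnson.

Lemma mu_johnson_bounds (n k : nat) :
  turan_number k n (suspension k C4) <= mu (johnson n k)
    <= turan_number k n (suspension k K4).
Proof.
apply/andP; split.
  by apply: turan_le_mu => X; apply: C4_free_mutual_visibility.
by apply: mu_le_turan => X; apply: mutual_visibility_K4_free.
Qed.

(** Complementation maps [J(n, k)] isomorphically onto [J(n, l)], as
    [~: A :\: ~: B] is [B :\: A]. *)
Lemma mu_johnson_compl_le (n k l : nat) : k + l = n ->
  mu (johnson n k) <= mu (johnson n l).
Proof.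
move=> kl.
have C1 (A : {A : {set 'I_n} | #|A| == k}) : #|~: val A| == l.
  by rewrite cardsCs setCK card_ord (eqP (valP A)); lia.
have C2 (A : {A : {set 'I_n} | #|A| == l}) : #|~: val A| == k.
  by rewrite cardsCs setCK card_ord (eqP (valP A)); lia.
apply: (@mu_isomorphism _ _ _ _ (fun A => Sub (~: val A) (C1 A))
  (fun A => Sub (~: val A) (C2 A))).
- by move=> A; apply: val_inj; rewrite /= setCK.
- by move=> A; apply: val_inj; rewrite /= setCK.
move=> A B; rewrite !johnsonE /= setDE setCK setIC -setDE.
by rewrite card_diffC.
Qed.

(** For [k = 2] the distance is at most two, so a single well-chosen exchange is
    enough and being free of [K4] replaces being free of [C4]: the endpoints
    are themselves in [X] and supply the two edges missing from the 4-cycle. *)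
Lemma mu_johnson2 (n : nat) :
  mu (johnson n 2) = turan_number 2 n (suspension 2 K4).
Proof.
apply/eqP; rewrite eqn_leq; have /andP[_ ->] /= := mu_johnson_bounds n 2.
apply: turan_le_mu => X K4free A B AX BX; rewrite vertex_neq => AB0.
have [AB1|AB2] := leqP #|val A :\: val B| 1.
  have {}AB1 : #|val A :\: val B| == 1 by rewrite eqn_leq AB1.
  apply: (@visible_of_walk _ _ _ _ _ [:: B]); rewrite /= ?johnsonE ?AB1 ?(eqP AB1) //.
  by move=> C; rewrite inE => /eqP.
have dAB : val A :\: val B = val A.
  by apply/eqP; rewrite eqEcard subsetDl card_vertex.
have dBA : val B :\: val A = val B.
  by apply/eqP; rewrite eqEcard subsetDl card_vertex -card_diffC.
suff [a [b [aA bB abX]]] : exists a b, [/\ a \in val A, b \in val B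
    & b |: val A :\ a \notin val @: X].
  have [||C [CE adjAC CB]] := @swap_vertex _ _ A B a b; rewrite ?dAB ?dBA //.
  apply: (@visible_of_walk _ _ _ _ _ [:: C; B]) => //=.
  - rewrite adjAC johnsonE -eqSS -CB andbT eqn_leq AB2 andbT.
    by rewrite dAB card_vertex.
  - by rewrite CB; move: CB; rewrite dAB card_vertex => -[<-].
  move=> D; rewrite !inE => /orP[/eqP->|/eqP//].
  by move=> CX; rewrite -CE imset_f in abX.
have /eqP/cards2P[a [a' [aa' AE]]] := card_vertex A.
have /eqP/cards2P[b [b' [bb' BE]]] := card_vertex B.
apply: contrapT => no_swap.
have swapX c d : c \in val A -> d \in val B -> d |: val A :\ c \in val @: X.
  by move=> cAB dBA'; apply: contrapT => /negP cdX; apply: no_swap; exists c, d.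
have nB c : c \in val A -> c \notin val B by rewrite -{1}dAB inE => /andP[].
have nA c : c \in val B -> c \notin val A by rewrite -{1}dBA inE => /andP[].
have Aa : val A :\ a = [set a'].
  apply/setP => x; rewrite AE !inE; case: (eqVneq x a) => [->|] //=.
  by rewrite (negbTE aa').
have Aa' : val A :\ a' = [set a].
  apply/setP => x; rewrite AE !inE; case: (eqVneq x a') => [->|] //=.
    by rewrite eq_sym (negbTE aa').
  by rewrite orbF.
have [aA a'A bB b'B] : [/\ a \in val A, a' \in val A, b \in val B & b' \in val B].
  by rewrite AE BE !inE !eqxx !orbT.
case/negP: K4free; apply/contains_suspensionP.
pose s := [:: a; a'; b; b'].
have su : uniq s.
  have := nB a aA; have := nB a' a'A; rewrite BE /= !inE !negb_or.
  by move=> /andP[-> ->] /andP[-> ->]; rewrite aa' bb'.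
exists set0, (fun i : 'I_4 => nth a s i); split.
- by rewrite cards0.
- by move=> i j /eqP; rewrite nth_uniq // => /eqP/val_inj.
- by move=> i; rewrite inE.
have pair c d : c \in s -> d \in s -> c != d -> [set c; d] \in val @: X.
  have imA : val A \in val @: X by rewrite imset_f.
  have imB : val B \in val @: X by rewrite imset_f.
  have := (swapX _ _ aA bB, swapX _ _ aA b'B, swapX _ _ a'A bB, swapX _ _ a'A b'B).
  rewrite Aa Aa' => -[[[s1 s2] s3] s4]; rewrite AE in imA; rewrite BE in imB.
  rewrite !inE => /or4P[]/eqP-> /or4P[]/eqP->; rewrite ?eqxx // => _ //;
    by rewrite setUC.
move=> _ /K4P[i [j [ij ->]]]; rewrite set0U imsetU !imset_set1.
by apply: pair; rewrite ?mem_nth // nth_uniq.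
Qed.

(** * Turan's theorem *)

Section Turan.
Variables (T : finType) (e : rel T).
Hypotheses (e_irr : irreflexive e) (e_sym : symmetric e).

Definition clique (Q : {set T}) : bool :=
  [forall x in Q, forall y in Q, (x != y) ==> e x y].

Lemma cliqueP (Q : {set T}) :
  reflect {in Q &, forall x y, x != y -> e x y} (clique Q).
Proof.
apply: (iffP forall_inP) => [cQ x y xQ yQ|cQ x xQ].
  by have /forall_inP/(_ y yQ)/implyP := cQ x xQ.
by apply/forall_inP => y yQ; apply/implyP; apply: cQ.
Qed.

(** Ordered pairs are counted, so that an edge inside [S] contributes twice to
    [arcs S S]; this avoids halving. *)
Definition arcs (S R : {set T}) : nat := \sum_(x in S) \sum_(y in R) e x y.

Lemma arcsC (S R : {set T}) : arcs S R = arcs R S.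
Proof.
rewrite /arcs exchange_big; apply: eq_bigr => x _; apply: eq_bigr => y _.
by rewrite e_sym.
Qed.

Lemma arcs_split (S Q : {set T}) : Q \subset S ->
  arcs S S = arcs (S :\: Q) (S :\: Q) + 2 * arcs (S :\: Q) Q + arcs Q Q.
Proof.
move=> /setIidPr QS.
have split (R : {set T}) : arcs S R = arcs Q R + arcs (S :\: Q) R.
  by rewrite /arcs (big_setID Q) QS.
have splitr (R : {set T}) : arcs R S = arcs R Q + arcs R (S :\: Q).
  by rewrite arcsC split !(arcsC R).
by rewrite split !splitr (arcsC Q (S :\: Q)); lia.
Qed.

Lemma sum_adj_lt (x z : T) (Q : {set T}) : z \in Q -> ~~ e x z ->
  \sum_(y in Q) e x y <= #|Q|.-1.
Proof.
move=> zQ xz; rewrite (bigD1 z) //= (negbTE xz) add0n (cardD1 z) zQ -sum1_card /=.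
rewrite [leqRHS](eq_bigl (fun y => (y \in Q) && (y != z))); last first.
  by move=> y; rewrite !inE andbC.
by apply: leq_sum => y _; apply: leq_b1.
Qed.

(** Turan's theorem for graphs without a clique of [r.+2] vertices.  If there is
    not even a clique of [r.+1] vertices, induction on [r] gives a better bound.
    Otherwise remove such a clique [Q]: each vertex outside has at most [r]
    neighbours in [Q], and the bound for [S :\: Q] adds up exactly, because
    [(m + r.+1) ^ 2 = m ^ 2 + 2 * m * r.+1 + r.+1 ^ 2]. *)
Lemma turan_bound (r : nat) (S : {set T}) :
  (forall Q : {set T}, Q \subset S -> clique Q -> #|Q| <> r.+2) ->
  r.+1 * arcs S S <= r * #|S| ^ 2.
Proof.
elim: r S => [|r IHr] S.
  move=> noQ; rewrite mul1n mul0n leqn0; apply/eqP.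
  rewrite /arcs big1 // => x xS; rewrite big1 // => y yS.
  apply/eqP; rewrite eqb0; apply/negP => xy.
  have xny : x != y by apply: contraTneq xy => ->; rewrite e_irr.
  apply: (noQ [set x; y]); last by rewrite cards2 xny.
    by apply/subsetP => z; rewrite !inE => /orP[]/eqP->.
  by apply/cliqueP => u v; rewrite !inE => /orP[]/eqP-> /orP[]/eqP->; rewrite ?eqxx // e_sym.
have [m] := ubnP #|S|; elim: m S => // m IHm S Sm noQ.
have [[Q [QS cQ cardQ]]|no_clique] :=
    pselect (exists Q : {set T}, [/\ Q \subset S, clique Q & #|Q| = r.+2]); last first.
  have /IHr : forall Q : {set T}, Q \subset S -> clique Q -> #|Q| <> r.+2.
    by move=> Q QS cQ cardQ; apply: no_clique; exists Q.
  by nia.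
have cardS : #|S| = #|S :\: Q| + r.+2.
  by rewrite -cardQ addnC -(cardsID Q S) (setIidPr QS).
have IH : r.+2 * arcs (S :\: Q) (S :\: Q) <= r.+1 * #|S :\: Q| ^ 2.
  apply: IHm => [|Q' Q'SQ]; first by move: Sm; rewrite cardS; lia.
  by apply: noQ; apply: subset_trans Q'SQ (subsetDl _ _).
have outer : arcs (S :\: Q) Q <= #|S :\: Q| * r.+1.
  rewrite /arcs -sum_nat_const; apply: leq_sum => x; rewrite inE => /andP[xQ xS].
  have [z zQ xz] : exists2 z, z \in Q & ~~ e x z.
    apply: contrapT => xadj.
    have {}xadj z : z \in Q -> e x z.
      by move=> zQ; apply: contrapT => /negP xz; apply: xadj; exists z.
    apply: (noQ (x |: Q)); last by rewrite cardsU1 xQ cardQ.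
      by rewrite subUset sub1set xS.
    apply/cliqueP => u v; rewrite !inE => /orP[/eqP->|uQ] /orP[/eqP->|vQ].
    - by rewrite eqxx.
    - by move=> _; apply: xadj.
    - by move=> _; rewrite e_sym; apply: xadj.
    - exact: (cliqueP _ cQ).
  by apply: leq_trans (sum_adj_lt zQ xz) _; rewrite cardQ.
have inner : arcs Q Q <= r.+2 * r.+1.
  rewrite /arcs -[in leqRHS]cardQ -sum_nat_const; apply: leq_sum => x xQ.
  by apply: leq_trans (sum_adj_lt xQ _) _; rewrite ?e_irr // cardQ.
by rewrite (arcs_split QS) cardS; nia.
Qed.

End Turan.

(** * The Turan number of K4 *)

Lemma sum_adjacency (V : finType) (H : {set {set V}}) : uniform 2 H ->
  \sum_(x : V) \sum_(y : V) ([set x; y] \in H) = 2 * #|H|.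
Proof.
move=> /forall_inP H2; rewrite pair_big /= -big_mkcond /=.
rewrite (partition_big (fun p : V * V => [set p.1; p.2]) (mem H)) //=.
rewrite mulnC -sum_nat_const; apply: eq_bigr => A AH.
have /cards2P[a [b [ab AE]]] := H2 A AH.
rewrite (eq_bigl (mem [set (a, b); (b, a)])) ?sum1_card ?cards2 ?xpair_eqE ?negb_and ?ab //.
move=> [x y]; rewrite !inE !xpair_eqE /=; apply/andP/idP => [[_ /eqP]|xy].
  rewrite AE => /setP xyE; have := (xyE x, xyE y, xyE a, xyE b); rewrite !inE !eqxx /= ?orbT.
  move=> [[[/esym/orP[]/eqP xE /esym/orP[]/eqP yE]]]; subst; rewrite ?eqxx ?orbT ?andbT //.
    by move=> _; rewrite orbb eq_sym (negbTE ab).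
  by rewrite orbb (negbTE ab).
have -> : [set x; y] = A.
  by case/orP: xy => /andP[/eqP-> /eqP->]; rewrite AE // setUC.
by rewrite AH eqxx.
Qed.

(** Twice the number of edges of the complete tripartite graph whose classes are
    the residues modulo 3. *)
Lemma sum_tripartite (n : nat) :
  \sum_(i < n) \sum_(j < n) (i %% 3 != j %% 3) = 2 * (n ^ 2 %/ 3).
Proof.
(* The new vertex [m] misses the [m %/ 3] earlier vertices of its class. *)
have row m : \sum_(i < m) (i %% 3 != m %% 3) = m - m %/ 3.
  have [d] := ubnP m; elim: d m => // d IHd [|[|[|m]]] md.
  - by rewrite big_ord0.
  - by rewrite big_ord_recr big_ord0.
  - by rewrite !big_ord_recr big_ord0.
  have {}IHd : \sum_(i < m) (i %% 3 != m %% 3) = m - m %/ 3 by apply: IHd; lia.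
  by rewrite !big_ord_recr /= (modnDl m 3 : m.+3 %% 3 = m %% 3) IHd; lia.
elim: n => [|n IHn]; first by rewrite big_ord0.
rewrite big_ord_recr /=; under eq_bigr do rewrite big_ord_recr /=.
rewrite big_split /= IHn row big_ord_recr /= eqxx addn0.
under eq_bigr do rewrite eq_sym.
rewrite row.
(* With [n = q * 3 + r], both squares reduce to [q ^ 2] and constants; [r] may
   be 3 here, as for [n.+1]. *)
have sq_div q r : (q * 3 + r) ^ 2 %/ 3 = 3 * q ^ 2 + 2 * q * r + r ^ 2 %/ 3.
  by rewrite (_ : _ ^ 2 = (3 * q ^ 2 + 2 * q * r) * 3 + r ^ 2) ?divnMDl //; lia.
have [q [r [r3 ->]]] : exists q r, r < 3 /\ n = q * 3 + r.
  by exists (n %/ 3), (n %% 3); rewrite ltn_mod -divn_eq.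
rewrite -addnS !sq_div divnMDl // {IHn row}.
by case: r r3 => [|[|[|]]] //= _; lia.
Qed.

Lemma turan_number_K4 (n : nat) :
  turan_number 2 n (suspension 2 K4) = n ^ 2 %/ 3.
Proof.
apply/eqP; rewrite eqn_leq; apply/andP; split.
  apply/bigmax_leqP => H /andP[H2 K4free].
  pose e (x y : 'I_n) := [set x; y] \in H.
  have e_sym : symmetric e by move=> x y; rewrite /e setUC.
  have e_irr : irreflexive e.
    move=> x; apply/negP => /(forall_inP H2); by rewrite setUid cards1.
  have := @turan_bound _ _ e_irr e_sym 2 [set: 'I_n].
  rewrite /arcs; under eq_bigl do rewrite inE; under eq_bigr do under eq_bigl do rewrite inE.
  rewrite sum_adjacency // cardsT card_ord => noQ.
  rewrite leq_divRL // mulnC -(leq_pmul2l (isT : 0 < 2)) mulnCA; apply: noQ.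
  move=> Q _ /cliqueP cQ cardQ; case/negP: K4free; apply/contains_suspensionP.
  have g_inj : injective (fun i : 'I_4 => enum_val (cast_ord (esym cardQ) i)).
    by move=> i j /enum_val_inj/cast_ord_inj.
  exists set0, (fun i : 'I_4 => enum_val (cast_ord (esym cardQ) i)); split=> //.
  - by rewrite cards0.
  - by move=> i; rewrite inE.
  move=> _ /K4P[i [j [ij ->]]]; rewrite set0U imsetU !imset_set1.
  by apply: cQ; rewrite ?enum_valP // (inj_eq g_inj).
(* The pairs with two colours, for the colouring by residues modulo 3; a [K4]
   would need four colours. *)
pose c (i : 'I_n) : 'I_3 := inord (i %% 3).
pose H := [set A : {set 'I_n} | (#|A| == 2) && (#|c @: A| == 2)].
have cE i j : (c i == c j) = (i %% 3 == j %% 3).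
  by rewrite -val_eqE /= !inordK // ltn_mod.
have inH i j : ([set i; j] \in H) = (i %% 3 != j %% 3).
  rewrite inE imsetU !imset_set1 !cards2 cE !eqSS !eqb1.
  by case: (eqVneq i j) => [->|]; rewrite ?eqxx.
have H2 : uniform 2 H by apply/forall_inP => A; rewrite inE => /andP[].
rewrite -(leq_pmul2l (isT : 0 < 2)) -sum_tripartite.
under eq_bigr do under eq_bigr do rewrite -inH.
rewrite sum_adjacency // leq_pmul2l //; apply: leq_bigmax_cond; rewrite H2 /=.
apply/negP => /contains_suspensionP[Y [g [cardY g_inj gY gH]]].
suff /leq_card : injective (c \o g) by rewrite !card_ord.
move=> i j /= /eqP; apply: contraTeq => ij; rewrite cE -inH.
have : [set i; j] \in K4 by apply/K4P; exists i, j.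
move=> /gH; rewrite imsetU !imset_set1.
by have /eqP := cardY; rewrite cards_eq0 => /eqP->; rewrite set0U.
Qed.

Theorem theorem13 (n k : nat) :
  (2 <= k -> k + 2 <= n ->
     turan_number k n (suspension k C4) <= mu (johnson n k) <= turan_number k n (suspension k K4))
  /\
  (4 <= n ->
     mu (johnson n 2) = mu (johnson n (n - 2)) /\
     mu (johnson n (n - 2)) = n ^ 2 %/ 3).
Proof.
split=> [_ _|n4]; first exact: mu_johnson_bounds.
have n2 : 2 + (n - 2) = n by lia.
have mu_compl : mu (johnson n 2) = mu (johnson n (n - 2)).
  by apply/eqP; rewrite eqn_leq !mu_johnson_compl_le // addnC.
by split=> //; rewrite -mu_compl mu_johnson2 turan_number_K4.
Qed.
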